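(* Let $q>1$ and let $f:(0,\infty)\times(0,\infty)\to\mathbb{R}$ satisfy (i) $f(x+1,y+1)=\dfrac{(1-q^x)(1-q^y)}{(1-q^{x+y})(1-q^{x+y+1})}\,f(x,y)$ for all $x,y>0$; (ii) for some $M>0$, $q^{xy}f(x,y)<q^{uv}f(u,v)$ whenever $x>u>M$ and $y>v>M$; (iii) $f(1,1)=1$. Then $f(x,y)=B_q(x,y)$ for all $x,y>0$.
   Context: For $q>1$ and $x,y>0$, the $q$-beta function is $B_q(x,y)=\frac{\Gamma_q(x)\Gamma_q(y)}{\Gamma_q(x+y)}$, where $\Gamma_q(x)=\frac{(q^{-1};q^{-1})_\infty}{(q^{-x};q^{-1})_\infty}(q-1)^{1-x}q^{\frac{x(x-1)}{2}}$ and $(a;t)_\infty=\prod_{k=0}^\infty(1-at^k)$ for $0<t<1$. *)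

(* Defs.v *)
From mathcomp Require Import all_boot all_order all_algebra.
From mathcomp Require Import all_classical all_reals all_analysis.
Set Implicit Arguments.
Unset Strict Implicit.
Unset Printing Implicit Defensive.
Import Order.TTheory GRing.Theory Num.Theory.
Import numFieldNormedType.Exports.
Local Open Scope classical_set_scope.
Local Open Scope ring_scope.

(* (a; t)_oo; the partial products converge when `|t| < 1, which is the only
   case used below. *)
Definition qPochhammer {R : realType} (a t : R) : R :=
  limn (fun n : nat => \prod_(0 <= k < n) (1 - a * t ^+ k)).

(* The q > 1 form of the q-gamma function. *)
Definition qGamma {R : realType} (q x : R) : R :=
  qPochhammer q^-1 q^-1 / qPochhammer (q `^ (- x)) q^-1
    * (q - 1) `^ (1 - x) * q `^ (x * (x - 1) / 2).

Definition qBeta {R : realType} (q x y : R) : R :=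
  qGamma q x * qGamma q y / qGamma q (x + y).

(* Main.v *)
Require Import Defs.
From mathcomp Require Import all_boot all_order all_algebra.
From mathcomp Require Import all_classical all_reals all_analysis.
From mathcomp Require Import ring lra.
Import Order.TTheory GRing.Theory Num.Theory.
Import numFieldNormedType.Exports.
Local Open Scope classical_set_scope.
Local Open Scope ring_scope.

(* Put [g x y = q^(xy) f x y]. The recurrence multiplies [g] by
   [(1 - q^-x) (1 - q^-y) / ((1 - q^-(x+y)) (1 - q^-(x+y+1)))], so
   [g (x + n) (y + n)] tends to
   [g x y * (q^-x)_oo (q^-y)_oo / (q^-(x+y))_oo], where [(a)_oo = (a; 1/q)_oo].
   Since [g] is eventually decreasing, sandwiching [(x + n, y + n)] between
   [(u + n - k, v + n - k)] and [(u + n + k, v + n + k)] shows that this limit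
   does not depend on [(x, y)]; its value at [(1, 1)] is [(q - 1) (1/q)_oo],
   and solving for [f x y] gives the q-beta function. *)

(** * Convergence and positivity of q-Pochhammer products *)

Lemma one_sub_ge_expR {R : realType} {a u : R} :
  0 <= u -> u <= a -> a < 1 -> expR (- (u / (1 - a))) <= 1 - u.
Proof.
move=> u0 ua a1; have u1 : 0 < 1 - u by lra.
have a1' : 0 < 1 - a by lra.
(* After inversion, [1 + z <= expR z] leaves [(1 - u)^-1 <= 1 + u / (1 - a)]. *)
rewrite expRN -[leRHS]invrK lef_pV2 ?posrE ?expR_gt0 ?invr_gt0//.
apply: le_trans (expR_ge1Dx _).
have -> : (1 - u)^-1 = 1 + u / (1 - u) by field; rewrite gt_eqF.
by rewrite lerD2l ler_wpM2l// lef_pV2 ?posrE//; lra.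
Qed.

(** Each factor is bounded below by an exponential, and the exponents sum to at most a geometric
    series. The bound is positive and independent of [n], so it gives both convergence and a nonzero
    limit. *)
Lemma qPochhammer_partial_ge {R : realType} {a t : R} (n : nat) :
  0 <= a < 1 -> 0 < t < 1 ->
  expR (- (a / (1 - t) / (1 - a))) <= \prod_(0 <= k < n) (1 - a * t ^+ k).
Proof.
move=> /andP[a0 a1] /andP[t0 t1].
have atk k : 0 <= a * t ^+ k <= a.
  by rewrite mulr_ge0 ?exprn_ge0 ?(ltW t0)//= ler_piMr// exprn_ile1// ltW.
apply: (@le_trans _ _ (\prod_(0 <= k < n) expR (- (a * t ^+ k / (1 - a))))).
  rewrite -expR_sum ler_expR sumrN lerN2 -mulr_suml ler_wpM2r ?invr_ge0 ?subr_ge0 ?(ltW a1)//.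
  have t1' : `|t| < 1 by rewrite ger0_norm ?(ltW t0).
  have := geometric_le_lim n a0 t0 t1'; rewrite seriesEnat; apply.
apply: ler_prod => k _; rewrite expR_ge0/=.
by have /andP[? ?] := atk k; exact: one_sub_ge_expR.
Qed.

Lemma cvg_qPochhammer {R : realType} {a t : R} :
  0 <= a < 1 -> 0 < t < 1 ->
  (\prod_(0 <= k < n) (1 - a * t ^+ k)) @[n --> \oo] --> qPochhammer a t.
Proof.
move=> a01 t01; apply: nonincreasing_is_cvgn.
  apply/nonincreasing_seqP => n; rewrite big_nat_recr//=.
  have /andP[a0 _] := a01; have /andP[t0 _] := t01.
  rewrite ler_piMr ?gerBl ?mulr_ge0 ?exprn_ge0 ?(ltW t0)//.
  exact: le_trans (expR_ge0 _) (qPochhammer_partial_ge n a01 t01).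
exists (expR (- (a / (1 - t) / (1 - a)))) => _ [n _ <-].
exact: qPochhammer_partial_ge.
Qed.

Lemma qPochhammer_gt0 {R : realType} {a t : R} :
  0 <= a < 1 -> 0 < t < 1 -> 0 < qPochhammer a t.
Proof.
move=> a01 t01; apply: (lt_le_trans (expR_gt0 (- (a / (1 - t) / (1 - a))))).
apply: limr_ge; first by apply/cvg_ex; eexists; exact: cvg_qPochhammer.
by apply: nearW => n; exact: qPochhammer_partial_ge.
Qed.

Lemma qPochhammer_recl {R : realType} {a t : R} :
  0 <= a < 1 -> 0 < t < 1 ->
  qPochhammer a t = (1 - a) * qPochhammer (a * t) t.
Proof.
move=> a01 t01; have /andP[a0 a1] := a01; have /andP[t0 t1] := t01.
have at01 : 0 <= a * t < 1.
  by rewrite mulr_ge0 ?(ltW t0)//= (le_lt_trans _ a1)// ler_piMr// ltW.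
have := cvg_qPochhammer a01 t01; rewrite -(cvg_shiftS _) => h.
apply: (cvg_unique _ h) => //.
have E n : (1 - a) * \prod_(0 <= k < n) (1 - a * t * t ^+ k) =
    \prod_(0 <= k < n.+1) (1 - a * t ^+ k).
  rewrite big_nat_recl// expr0 mulr1; congr (_ * _).
  by apply: eq_bigr => k _; rewrite exprS mulrA.
rewrite /= -(funext E).
exact: cvgMr (cvg_qPochhammer at01 t01).
Qed.

(** * Real powers, limits along diagonals, and one algebraic identity *)

Lemma powR_gt1 {R : realType} {q x : R} : 1 < q -> 0 < x -> 1 < q `^ x.
Proof.
move=> q1 x0; rewrite /powR gt_eqF; last by lra.
by rewrite expR_gt1 mulr_gt0// ln_gt0.
Qed.

Lemma powRN_itv {R : realType} {q x : R} :
  1 < q -> 0 < x -> 0 <= q `^ (- x) < 1.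
Proof.
by move=> q1 x0; rewrite powR_ge0 powRN invf_lt1 ?powR_gt1// powR_gt0; lra.
Qed.

Lemma diag_lim_le {R : realType} (g : R -> R -> R) {M x y u v a b : R} :
  (forall x y u v : R, M < u -> u < x -> M < v -> v < y -> g x y < g u v) ->
  0 < u -> 0 < v ->
  g (x + n%:R) (y + n%:R) @[n --> \oo] --> a ->
  g (u + n%:R) (v + n%:R) @[n --> \oo] --> b ->
  a <= b.
Proof.
move=> gdecr u0 v0 ga gb.
(* A shift by [k], which leaves the limit [a] unchanged, pushes the first diagonal strictly past the
   second in both coordinates. *)
pose k := (Num.truncn (Num.max (u - x) (v - y))).+1.
have : Num.max (u - x) (v - y) < k%:R by exact: truncnS_gt.
rewrite gt_max => /andP[ku kv].
move: ga; rewrite -(cvg_shiftn k) => ga; apply: (ler_cvg_to ga gb).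
near=> n; have Mn : M < n%:R by near: n; exact: nbhs_infty_gtr.
have shift_lt s t : s - t < k%:R -> s + n%:R < t + (n + k)%N%:R.
  by rewrite natrD ltrBlDl addrCA addrC ltrD2r addrC.
by apply/ltW/gdecr; rewrite ?shift_lt// ltr_wpDl// ltW.
Unshelve. all: by end_near. Qed.

(** With [a = q^X] and [b = q^Y], the leading [a * b * q] is the growth of [q^(XY)] when both
    coordinates increase by 1; it turns the recurrence factor into one in negative powers. *)
Lemma qbeta_factor {F : fieldType} {a b q : F} :
  a != 0 -> b != 0 -> q != 0 -> a * b != 1 -> a * b * q != 1 ->
  a * b * q * ((1 - a) * (1 - b) / ((1 - a * b) * (1 - a * b * q)))
    * ((1 - (a * b)^-1) * (1 - (a * b * q)^-1)) =
  (1 - a^-1) * (1 - b^-1).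
Proof.
move=> a0 b0 q0 ab1 abq1; rewrite eq_sym -subr_eq0 in ab1.
by rewrite eq_sym -subr_eq0 in abq1; field; rewrite a0 b0 q0 ab1 abq1.
Qed.

(** * The q-beta function and the iterated recurrence *)

Section base_gt1.
Context {R : realType} {q : R}.
Hypothesis q_gt1 : 1 < q.

Let q_gt0 : 0 < q. Proof. exact: lt_trans ltr01 q_gt1. Qed.

Let q_neq0 : q != 0. Proof. by rewrite gt_eqF. Qed.

Let qV01 : 0 < q^-1 < 1.
Proof. by rewrite invr_gt0 q_gt0 invf_lt1. Qed.

Let powRDq x y : q `^ (x + y) = q `^ x * q `^ y.
Proof. by rewrite powRD// q_neq0 implybT. Qed.

Lemma qPochhammer_powR_gt0 (x : R) :
  0 < x -> 0 < qPochhammer (q `^ (- x)) q^-1.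
Proof. by move=> x0; apply: qPochhammer_gt0 => //; exact: powRN_itv. Qed.

Lemma qBetaE (x y : R) : 0 < x -> 0 < y ->
  q `^ (x * y) * qBeta q x y =
  (q - 1) * qPochhammer q^-1 q^-1 * qPochhammer (q `^ (- (x + y))) q^-1
    / (qPochhammer (q `^ (- x)) q^-1 * qPochhammer (q `^ (- y)) q^-1).
Proof.
move=> x0 y0.
have [Px Py Pxy] : [/\ 0 < qPochhammer (q `^ (- x)) q^-1,
    0 < qPochhammer (q `^ (- y)) q^-1 &
    0 < qPochhammer (q `^ (- (x + y))) q^-1].
  by split; apply: qPochhammer_powR_gt0 => //; rewrite addr_gt0.
have P1 : 0 < qPochhammer q^-1 q^-1.
  by apply: qPochhammer_gt0 => //; case/andP: qV01 => /ltW -> ->.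
have q10 : q - 1 != 0 by rewrite subr_eq0 gt_eqF.
(* The weight [q^(xy)] is exactly what cancels the quadratic powers in the three q-gamma factors. *)
have Eq : q `^ (x * y) * q `^ (x * (x - 1) / 2) * q `^ (y * (y - 1) / 2) =
    q `^ ((x + y) * (x + y - 1) / 2).
  by rewrite -!powRDq; congr (_ `^ _); field.
have Eq1 : (q - 1) `^ (1 - x) * (q - 1) `^ (1 - y) =
    (q - 1) * (q - 1) `^ (1 - (x + y)).
  have D u v : (q - 1) `^ (u + v) = (q - 1) `^ u * (q - 1) `^ v.
    by rewrite powRD// q10 implybT.
  rewrite -[X in _ = X * _](powRr1 (_ : 0 <= q - 1)) ?subr_ge0 ?ltW//.
  by rewrite -!D; congr (_ `^ _); ring.
rewrite /qBeta /qGamma -Eq.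
have E1 : 0 < (q - 1) `^ (1 - (x + y)) by rewrite powR_gt0 ?subr_gt0.
have := Eq1; move: E1.
move: ((q - 1) `^ (1 - (x + y))) ((q - 1) `^ (1 - x)) ((q - 1) `^ (1 - y)) => c a b c0 abc.
have A1 := powR_gt0 (x * y) q_gt0.
have A2 := powR_gt0 (x * (x - 1) / 2) q_gt0.
have A3 := powR_gt0 (y * (y - 1) / 2) q_gt0.
(* Eliminating [q - 1] builds [Eq1] into the goal, leaving a rational identity in independent
   atoms. *)
have -> : q - 1 = a * b / c by rewrite abc mulfK ?gt_eqF.
by field; rewrite !gt_eqF.
Qed.

Context {f : R -> R -> R}.
Hypothesis f_rec : forall x y : R, 0 < x -> 0 < y ->
  f (x + 1) (y + 1) =
    (1 - q `^ x) * (1 - q `^ y)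
      / ((1 - q `^ (x + y)) * (1 - q `^ (x + y + 1))) * f x y.

(** A diagonal step raises [x + y] by 2, so it uses two factors of the product for [x + y]: hence
    [2 * n]. Cross-multiplying avoids division in the induction. *)
Lemma qbeta_rec_iter (x y : R) (n : nat) : 0 < x -> 0 < y ->
  q `^ ((x + n%:R) * (y + n%:R)) * f (x + n%:R) (y + n%:R)
    * \prod_(0 <= k < 2 * n) (1 - q `^ (- (x + y)) * q^-1 ^+ k) =
  q `^ (x * y) * f x y
    * (\prod_(0 <= k < n) (1 - q `^ (- x) * q^-1 ^+ k)
       * \prod_(0 <= k < n) (1 - q `^ (- y) * q^-1 ^+ k)).
Proof.
move=> x0 y0; elim: n => [|n IHn].
  by rewrite muln0 !big_nil !addr0 !mulr1.
have xn0 : 0 < x + n%:R by rewrite ltr_wpDr.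
have yn0 : 0 < y + n%:R by rewrite ltr_wpDr.
rewrite mulnS !addSn add0n 4?big_nat_recr//=.
set Px := \prod_(0 <= i < n) (1 - q `^ (- x) * q^-1 ^+ i) in IHn *.
set Py := \prod_(0 <= i < n) (1 - q `^ (- y) * q^-1 ^+ i) in IHn *.
set Pxy := \prod_(0 <= i < 2 * n) _ in IHn *.
have Ex z k : q `^ (- z) * q^-1 ^+ k = (q `^ (z + k%:R))^-1.
  by rewrite powRDq powR_mulrn ?(ltW q_gt0)// powRN invfM exprVn.
have E1 : q `^ (x + y + (2 * n)%:R) = q `^ (x + n%:R) * q `^ (y + n%:R).
  by rewrite -powRDq natrM; congr (_ `^ _); ring.
have E2 : q `^ (x + y + (2 * n).+1%:R) = q `^ (x + n%:R) * q `^ (y + n%:R) * q.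
  by rewrite -{4}(powRr1 (ltW q_gt0)) -!powRDq -natr1 natrM; congr (_ `^ _); ring.
rewrite (Ex x n) (Ex y n) (Ex (x + y) (2 * n)%N) (Ex (x + y) (2 * n).+1) E1 E2.
rewrite -(natr1 n) !addrA f_rec//.
move: IHn xn0 yn0; move: (x + n%:R) (y + n%:R) => X Y IHn X0 Y0.
have -> : (X + 1) * (Y + 1) = X * Y + X + Y + 1 by ring.
rewrite !powRDq powRr1 ?(ltW q_gt0)//.
have A1 : 1 < q `^ X by exact: powR_gt1.
have B1 : 1 < q `^ Y by exact: powR_gt1.
have AB1 : 1 < q `^ X * q `^ Y by rewrite mulr_egt1.
have ABq1 : 1 < q `^ X * q `^ Y * q by rewrite mulr_egt1.
rewrite [RHS](_ : _ = q `^ (x * y) * f x y * (Px * Py)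
    * ((1 - (q `^ X)^-1) * (1 - (q `^ Y)^-1))); last by ring.
rewrite -IHn -(@qbeta_factor _ (q `^ X) (q `^ Y) q) ?gt_eqF ?powR_gt0//.
by ring.
Qed.

Lemma cvg_qbeta_rec {x y : R} : 0 < x -> 0 < y ->
  (q `^ ((x + n%:R) * (y + n%:R)) * f (x + n%:R) (y + n%:R)) @[n --> \oo] -->
  q `^ (x * y) * f x y
    * (qPochhammer (q `^ (- x)) q^-1 * qPochhammer (q `^ (- y)) q^-1)
    / qPochhammer (q `^ (- (x + y))) q^-1.
Proof.
move=> x0 y0; have xy0 : 0 < x + y by rewrite addr_gt0.
have cvgP z : 0 < z -> (\prod_(0 <= k < n) (1 - q `^ (- z) * q^-1 ^+ k))
    @[n --> \oo] --> qPochhammer (q `^ (- z)) q^-1.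
  by move=> z0; apply: cvg_qPochhammer => //; exact: powRN_itv.
have P_neq0 n : \prod_(0 <= k < n) (1 - q `^ (- (x + y)) * q^-1 ^+ k) != 0.
  rewrite gt_eqF//; apply: lt_le_trans (expR_gt0 _) (qPochhammer_partial_ge n _ _) => //.
  exact: powRN_itv.
have E n : q `^ (x * y) * f x y
      * (\prod_(0 <= k < n) (1 - q `^ (- x) * q^-1 ^+ k)
         * \prod_(0 <= k < n) (1 - q `^ (- y) * q^-1 ^+ k))
      * (\prod_(0 <= k < 2 * n) (1 - q `^ (- (x + y)) * q^-1 ^+ k))^-1 =
    q `^ ((x + n%:R) * (y + n%:R)) * f (x + n%:R) (y + n%:R).
  by rewrite -qbeta_rec_iter// mulfK.
rewrite -(funext E); apply: cvgM.
  by apply: cvgMr; apply: cvgM; exact: cvgP.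
apply: cvgV; first by rewrite gt_eqF// qPochhammer_powR_gt0.
(* The denominators are the partial products of even length, a subsequence with the same limit. *)
apply: (@cvg_comp _ _ _ (muln 2)
  (fun n => \prod_(0 <= k < n) (1 - q `^ (- (x + y)) * q^-1 ^+ k)) _ \oo _).
  exact: cvg_mulnl.
exact: cvgP.
Qed.

End base_gt1.

Theorem theorem6p7 (R : realType) (q : R) (hq : 1 < q) (f : R -> R -> R)
  (hrec : forall x y : R, 0 < x -> 0 < y ->
     f (x + 1) (y + 1) =
       (1 - q `^ x) * (1 - q `^ y)
         / ((1 - q `^ (x + y)) * (1 - q `^ (x + y + 1))) * f x y)
  (hdecr : exists M : R, 0 < M /\
     forall x y u v : R, M < u -> u < x -> M < v -> v < y ->
       q `^ (x * y) * f x y < q `^ (u * v) * f u v)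
  (hone : f 1 1 = 1) :
  forall x y : R, 0 < x -> 0 < y -> f x y = qBeta q x y.
Proof.
move=> x y x0 y0; have [M [_ gdecr]] := hdecr.
have q0 : 0 < q := lt_trans ltr01 hq.
have lim_xy := cvg_qbeta_rec hq hrec x0 y0.
have lim_11 := cvg_qbeta_rec hq hrec ltr01 ltr01.
have := diag_lim_le (fun x y => q `^ (x * y) * f x y) gdecr x0 y0 lim_11 lim_xy.
have := diag_lim_le (fun x y => q `^ (x * y) * f x y) gdecr ltr01 ltr01 lim_xy lim_11.
move=> le1 le2; have {le1 le2} := le_anti (introT andP (conj le1 le2)).
have qV01 : 0 < q^-1 < 1 by rewrite invr_gt0 q0 invf_lt1.
have qV01' : 0 <= q^-1 < 1 by case/andP: qV01 => /ltW -> ->.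
(* Peeling off the first factor simplifies the limit at (1, 1), where the denominator is the product
   starting at [q^-2]. *)
have EP : qPochhammer q^-1 q^-1 =
    (1 - q^-1) * qPochhammer (q `^ (- (1 + 1))) q^-1.
  rewrite [LHS](qPochhammer_recl qV01' qV01) -[1 + 1]/(2%:R) powR_invn ?(ltW q0)//.
  by rewrite expr2 invfM.
have P2 : 0 < qPochhammer (q `^ (- (1 + 1))) q^-1.
  by apply: qPochhammer_powR_gt0 => //; rewrite addr_gt0.
have Px : 0 < qPochhammer (q `^ (- x)) q^-1 by exact: qPochhammer_powR_gt0.
have Py : 0 < qPochhammer (q `^ (- y)) q^-1 by exact: qPochhammer_powR_gt0.
have Pxy : 0 < qPochhammer (q `^ (- (x + y))) q^-1.
  by apply: qPochhammer_powR_gt0 => //; rewrite addr_gt0.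
have qxy : q `^ (x * y) != 0 by rewrite gt_eqF// powR_gt0.
rewrite hone !mulr1 (powRr1 (ltW q0)) powR_inv1 ?(ltW q0)// => h.
apply: (mulfI qxy); rewrite qBetaE//.
have PxPy := mulf_neq0 (lt0r_neq0 Px) (lt0r_neq0 Py).
(* The left side is completed to the limit from [(x, y)], so that [h] can replace it by the one from
   (1, 1). *)
rewrite -[LHS](mulfK PxPy) -[X in X / _](divfK (lt0r_neq0 Pxy)) h EP.
by field; rewrite !gt_eqF.
Qed.
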